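(* Let $X$ be a smooth complex projective surface, $\omega\in\mathrm{NS}(X)$ ample, $\gamma\in\mathrm{NS}_{\mathbb Q}(X)$ orthogonal to $\omega$, $g=\omega^2$, $d=-\gamma^2$, $u\in\mathbb R$. Let $v=(x,\,y_1\omega+y_2\gamma+\alpha,\,z)$ be a Bogomolov class and $w=(r,\,c_1\omega+c_2\gamma+\alpha',\,\chi)$ with $\alpha,\alpha'\in\langle\omega,\gamma\rangle^\perp$ and $xc_1-ry_1\neq0$. Put $$C=\frac{x\chi-rz+ud(xc_2-ry_2)}{g(xc_1-ry_1)},$$ $$D=\frac{2zc_1-2c_2udy_1-xu^2dc_1+2y_2udc_1-2\chi y_1+ru^2dy_1}{g(xc_1-ry_1)},$$ so that the real pseudo-wall $\mu_Z(w)=\mu_Z(v)$ in $\Pi_{\gamma,\omega,u}$ is the semicircle with centre $(C,0)$ and radius $R=\sqrt{D+C^2}$. If $x\neq0$, then $$D=\frac{ud(2y_2-ux)+2z}{gx}-\frac{2y_1}{x}C .$$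
   Context: Classes in $\mathrm N_{\mathbb R}(X)=\mathrm N(X)\otimes\mathbb R$ are written (rank, $c_1$, $\mathrm{ch}_2$). A class is a Bogomolov class if $c_1^2\ge 2r\,\mathrm{ch}_2$. $\Pi_{\gamma,\omega,u}$ is the half-plane, with coordinates $(s,t)$, $t>0$, of stability conditions with central charge $Z=Z_{s\omega+u\gamma,t\omega}$, where $Z_{\beta,\omega}(r,\theta,z)=-z+\theta\cdot\beta-\tfrac r2(\beta^2-\omega^2)+i(\theta-r\beta)\cdot\omega$ and $\mu_Z=-\mathrm{Re}\,Z/\mathrm{Im}\,Z$. If $\gamma=0$ take $d=0$, $y_2=c_2=0$.
   Formalization: The pseudo-wall is proved to be the semicircle with the points where Z(w)=0 removed, since μ_Z(w) is undefined (0/0) there and such a point can lie on the semicircle when w is not a Bogomolov class. *)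

(* Defs.v *)
From HB Require Import structures.
From mathcomp Require Import all_boot all_order all_algebra.
From mathcomp Require Import all_classical all_reals.
From mathcomp Require Import complex.

Set Implicit Arguments.
Unset Strict Implicit.
Unset Printing Implicit Defensive.

Import Order.TTheory GRing.Theory Num.Theory.

Local Open Scope classical_set_scope.
Local Open Scope ring_scope.

(* The symmetric bilinear pairing on R^n whose Gram matrix is the integer
   matrix G. *)
Definition pairing (R : realType) (n : nat) (G : 'M[int]_n) (a b : 'rV[R]_n) : R :=
  (a *m map_mx intr G *m b^T) 0 0.

(* The numerical data of a smooth complex projective surface X, axiomatised;
   schemes are not available, and X enters only through these data.  The group
   NS(X), taken modulo torsion, is identified with Z^rho by the choice of a
   basis, so that NS_Q(X) and NS_R(X) become Q^rho and R^rho.  [ns_hodge] is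
   the Hodge index theorem, with equality D^2 = 0 excluded because classes are
   taken up to numerical equivalence. *)
Record neron_severi (R : realType) := NeronSeveri {
  ns_rho : nat;
  ns_form : 'M[int]_ns_rho;
  ns_sym : ns_form^T = ns_form;
  ns_ample : 'rV[int]_ns_rho -> Prop;
  ns_ample_gt0 : forall h : 'rV[int]_ns_rho, ns_ample h ->
    0 < pairing ns_form (map_mx intr h : 'rV[R]_ns_rho) (map_mx intr h);
  ns_hodge : forall (h : 'rV[int]_ns_rho) (D : 'rV[R]_ns_rho), ns_ample h ->
    pairing ns_form (map_mx intr h) D = 0 -> D != 0 ->
    pairing ns_form D D < 0
}.

Definition NS_R (R : realType) (X : neron_severi R) := 'rV[R]_(ns_rho X).

Definition dot (R : realType) (X : neron_severi R) (a b : NS_R X) : R :=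
  pairing (ns_form X) a b.

(* Elements (rank, c_1, ch_2) of N(X) (x) R. *)
Record Nclass (R : realType) (X : neron_severi R) := NClass {
  rk : R;
  ch1 : NS_R X;
  ch2 : R
}.

Definition bogomolov (R : realType) (X : neron_severi R) (e : Nclass X) : Prop :=
  dot (ch1 e) (ch1 e) >= 2 * rk e * ch2 e.

Definition central_charge (R : realType) (X : neron_severi R)
    (beta omega : NS_R X) (e : Nclass X) : R[i] :=
  Complex
    (- ch2 e + dot (ch1 e) beta - rk e / 2 * (dot beta beta - dot omega omega))
    (dot (ch1 e - rk e *: beta) omega).

(* mu = - Re Z / Im Z, equal to +oo when Im Z = 0; meaningful for Z <> 0. *)
Definition slope (R : realType) (Z : R[i]) : \bar R :=
  if complex.Im Z == 0 then +oo%E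
  else (- complex.Re Z / complex.Im Z)%:E.

Definition plane_charge (R : realType) (X : neron_severi R)
    (gamma omega : NS_R X) (u : R) (p : R * R) (e : Nclass X) : R[i] :=
  central_charge (p.1 *: omega + u *: gamma) (p.2 *: omega) e.

Definition pseudo_wall (R : realType) (X : neron_severi R)
    (gamma omega : NS_R X) (u : R) (v w : Nclass X) : set (R * R) :=
  [set p | 0 < p.2 /\
    slope (plane_charge gamma omega u p w)
      = slope (plane_charge gamma omega u p v)].

Definition semicircle (R : realType) (C rad : R) : set (R * R) :=
  [set p | 0 < p.2 /\ (p.1 - C) ^+ 2 + p.2 ^+ 2 = rad ^+ 2].

(* Main.v *)
Require Import Defs.
From HB Require Import structures.
From mathcomp Require Import all_boot all_order all_algebra.
From mathcomp Require Import all_classical all_reals.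
From mathcomp Require Import complex.
From mathcomp Require Import ring lra.

(* Up to the nonzero factor [t * g^2 * (x * c1 - r * y1) / 2], the cross
   product of the charges of [v] and [w] is the equation of the semicircle, so
   the two loci can only differ where a charge vanishes.  The imaginary parts
   never vanish together because [x * c1 - r * y1 != 0].  For the same reason
   [Z v = 0] forces [x != 0], and it would give
     [x^2 g t^2 + d (y2 - u x)^2 - alpha^2 <= 0]
   by the Bogomolov inequality, against the Hodge index theorem; only the
   zeros of [Z w] have to be removed from the semicircle. *)

Set Implicit Arguments.
Unset Strict Implicit.
Unset Printing Implicit Defensive.

Import Order.TTheory GRing.Theory Num.Theory.

Local Open Scope classical_set_scope.
Local Open Scope ring_scope.

Section Dot.
Variables (R : realType) (X : neron_severi R).
Implicit Types a b c : NS_R X.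

Lemma dotDl a b c : dot (a + b) c = dot a c + dot b c.
Proof. by rewrite /dot /pairing !mulmxDl mxE. Qed.

Lemma dotZl k a b : dot (k *: a) b = k * dot a b.
Proof. by rewrite /dot /pairing -!scalemxAl mxE. Qed.

Lemma dotC a b : dot a b = dot b a.
Proof.
rewrite /dot /pairing; set G := map_mx _ _.
have -> : (a *m G *m b^T) 0 0 = (a *m G *m b^T)^T 0 0 by rewrite [RHS]mxE.
by rewrite !trmx_mul trmxK /G map_trmx ns_sym mulmxA.
Qed.

Lemma dotDr a b c : dot a (b + c) = dot a b + dot a c.
Proof. by rewrite dotC dotDl !(dotC a). Qed.

Lemma dotZr k a b : dot a (k *: b) = k * dot a b.
Proof. by rewrite dotC dotZl (dotC a). Qed.

Lemma dotNl a b : dot (- a) b = - dot a b.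
Proof. by rewrite -scaleN1r dotZl mulN1r. Qed.

Lemma hodge_le0 (h : 'rV[int]_(ns_rho X)) a :
  ns_ample h -> dot a (map_mx intr h) = 0 -> dot a a <= 0.
Proof.
move=> ah ha; have [->|a0] := eqVneq a 0.
  by rewrite -[X in dot X _](scale0r 0) dotZl mul0r.
by apply/ltW/(ns_hodge ah) => //; rewrite -[LHS]/(dot _ a) dotC.
Qed.

End Dot.

Lemma slope_eqP (R : realType) (Z1 Z2 : R[i]) :
  (complex.Im Z1 == 0) && (complex.Im Z2 == 0) = false ->
  slope Z1 = slope Z2 <->
  [/\ complex.Im Z1 != 0, complex.Im Z2 != 0 &
      complex.Re Z1 * complex.Im Z2 = complex.Re Z2 * complex.Im Z1].
Proof.
rewrite /slope; case: eqVneq => [i1|i1]; case: eqVneq => [i2|i2] //= _.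
- by split => // -[].
- by split => // -[].
- split=> [[/eqP]|[_ _ e]].
    by rewrite eqr_div // => /eqP e; split=> //; lra.
  by congr (_%:E); apply/eqP; rewrite eqr_div // !mulNr e.
Qed.

Lemma plane_chargeE (R : realType) (X : neron_severi R)
    (gamma omega alpha : NS_R X) (u s t x y1 y2 z : R) :
  dot gamma omega = 0 -> dot alpha omega = 0 -> dot alpha gamma = 0 ->
  plane_charge gamma omega u (s, t)
      (NClass x (y1 *: omega + y2 *: gamma + alpha) z) =
  Complex (- z + s * y1 * dot omega omega + u * y2 * dot gamma gamma
           - x / 2 * ((s ^+ 2 - t ^+ 2) * dot omega omega
                      + u ^+ 2 * dot gamma gamma))
          (t * dot omega omega * (y1 - s * x)).
Proof.
move=> go ao ag; rewrite /plane_charge /central_charge /=.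
rewrite !(dotDl, dotDr, dotNl, dotZl, dotZr) (dotC omega gamma) go ao ag.
by congr Complex; ring.
Qed.

Lemma plane_charge_neq0 (R : realType) (X : neron_severi R)
    (omegaZ : 'rV[int]_(ns_rho X)) (gamma alpha : NS_R X)
    (u s t x y1 y2 z : R) :
  let omega : NS_R X := map_mx intr omegaZ in
  let v := NClass x (y1 *: omega + y2 *: gamma + alpha) z in
  ns_ample omegaZ ->
  dot gamma omega = 0 -> dot alpha omega = 0 -> dot alpha gamma = 0 ->
  bogomolov v -> x != 0 -> 0 < t ->
  plane_charge gamma omega u (s, t) v != 0.
Proof.
move=> omega v amp go ao ag bog x0 t0; apply/eqP.
have g0 : 0 < dot omega omega := ns_ample_gt0 amp.
rewrite plane_chargeE // => -[re0 /eqP].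
rewrite !mulf_eq0 (gt_eqF t0) (gt_eqF g0) //= subr_eq0 => /eqP y1E.
move: bog; rewrite /bogomolov /= !(dotDl, dotDr, dotZl, dotZr).
rewrite (dotC omega gamma) (dotC omega alpha) (dotC gamma alpha) go ao ag.
have pos : 0 < x ^+ 2 * (dot omega omega * t ^+ 2).
  by rewrite mulr_gt0 ?exprn_even_gt0 ?mulr_gt0 ?exprn_gt0.
have gg : dot gamma gamma * (y2 - u * x) ^+ 2 <= 0.
  by rewrite mulr_le0_ge0 ?sqr_ge0 ?(hodge_le0 amp).
have aa : dot alpha alpha <= 0 := hodge_le0 amp ao.
move: re0; rewrite y1E => re0 bog.
have := congr1 ( *%R (2 * x)) re0; rewrite mulr0; lra.
Qed.

Theorem lemma2p3 (R : realType) (X : neron_severi R)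
    (omegaZ : 'rV[int]_(ns_rho X)) (gammaQ : 'rV[rat]_(ns_rho X))
    (u x y1 y2 z r c1 c2 chi : R) (alpha alpha' : NS_R X) :
  let omega : NS_R X := map_mx intr omegaZ in
  let gamma : NS_R X := map_mx ratr gammaQ in
  let g := dot omega omega in
  let d := - dot gamma gamma in
  let v := NClass x (y1 *: omega + y2 *: gamma + alpha) z in
  let w := NClass r (c1 *: omega + c2 *: gamma + alpha') chi in
  let C := (x * chi - r * z + u * d * (x * c2 - r * y2))
           / (g * (x * c1 - r * y1)) in
  let D := (2 * z * c1 - 2 * c2 * u * d * y1 - x * u ^+ 2 * d * c1
            + 2 * y2 * u * d * c1 - 2 * chi * y1 + r * u ^+ 2 * d * y1)
           / (g * (x * c1 - r * y1)) in
  ns_ample omegaZ ->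
  dot gamma omega = 0 ->
  (gammaQ = 0 -> y2 = 0 /\ c2 = 0) ->
  dot alpha omega = 0 -> dot alpha gamma = 0 ->
  dot alpha' omega = 0 -> dot alpha' gamma = 0 ->
  bogomolov v ->
  x * c1 - r * y1 != 0 ->
  pseudo_wall gamma omega u v w
    = semicircle C (Num.sqrt (D + C ^+ 2))
      `\` [set p | plane_charge gamma omega u p w = 0]
  /\ (x != 0 ->
      D = (u * d * (2 * y2 - u * x) + 2 * z) / (g * x) - 2 * y1 / x * C).
Proof.
move=> omega gamma g d v w C D amp go _ ao ag a'o a'g bog K0.
have g0 : 0 < g := ns_ample_gt0 amp.
have g0' : g != 0 by rewrite gt_eqF.
split; last by move=> x0; rewrite /C /D; field; rewrite K0 g0'.
have im0 (s t : R) : 0 < t ->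
    (complex.Im (plane_charge gamma omega u (s, t) w) == 0) &&
    (complex.Im (plane_charge gamma omega u (s, t) v) == 0) = false.
  move=> t0; rewrite !plane_chargeE //= -/g !mulf_eq0 (gt_eqF t0) (negPf g0') /=.
  apply: contraNF K0 => /andP[]; rewrite !subr_eq0 => /eqP -> /eqP ->.
  by apply/eqP; ring.
have cross (s t : R) : 0 < t ->
    complex.Re (plane_charge gamma omega u (s, t) w) *
      complex.Im (plane_charge gamma omega u (s, t) v) =
    complex.Re (plane_charge gamma omega u (s, t) v) *
      complex.Im (plane_charge gamma omega u (s, t) w) <->
    (s - C) ^+ 2 + t ^+ 2 = D + C ^+ 2.
  move=> t0; rewrite !plane_chargeE //= -/g.
  have -> : dot gamma gamma = - d by rewrite opprK.
  set lhs := (X in X = _ <-> _); set rhs := (X in _ = X <-> _).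
  have E : lhs - rhs = (t * g ^+ 2 * (x * c1 - r * y1) / 2) *
                       (D + C ^+ 2 - ((s - C) ^+ 2 + t ^+ 2)).
    by rewrite /lhs /rhs /C /D; field; rewrite K0 g0'.
  have k0 : t * g ^+ 2 * (x * c1 - r * y1) / 2 != 0.
    by rewrite !mulf_eq0 invr_eq0 (gt_eqF t0) (negPf g0') (negPf K0) pnatr_eq0.
  split=> [e|e]; apply/eqP; last by rewrite -subr_eq0 E e subrr mulr0.
  move/eqP: E; rewrite e subrr eq_sym mulf_eq0 (negPf k0) /=.
  by rewrite subr_eq0 eq_sym.
have rad (s t : R) : 0 < t ->
    (s - C) ^+ 2 + t ^+ 2 = Num.sqrt (D + C ^+ 2) ^+ 2 <->
    (s - C) ^+ 2 + t ^+ 2 = D + C ^+ 2.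
  move=> t0; have p : 0 < (s - C) ^+ 2 + t ^+ 2.
    by rewrite ltr_wpDl ?sqr_ge0 ?exprn_gt0.
  have [q|q] := leP 0 (D + C ^+ 2); first by rewrite sqr_sqrtr.
  by rewrite ler0_sqrtr ?ltW // expr0n /=; split=> e; lra.
have Z0 (Z : R[i]) : complex.Re Z = 0 -> complex.Im Z = 0 -> Z = 0.
  by case: Z => a b /= -> ->.
apply/seteqP; split=> -[s t] /=.
  move=> [t0 /(slope_eqP (im0 s t t0))[iw iv /(cross s t t0)/(rad s t t0) e]].
  by split=> // Zw0; rewrite Zw0 eqxx in iw.
move=> [[t0 /(rad s t t0)/(cross s t t0) e] Zw0]; split=> //.
apply/(slope_eqP (im0 s t t0)); split=> //; apply/eqP => i0.
  move: e (im0 s t t0); rewrite i0 mulr0 eqxx /= => /eqP.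
  rewrite mulf_eq0 => /orP[/eqP r0 _|-> //].
  by apply: Zw0; apply: Z0.
move: e (im0 s t t0); rewrite i0 mulr0 eqxx andbT => /esym/eqP.
rewrite mulf_eq0 => /orP[/eqP r0 _|-> //].
have Zv0 : plane_charge gamma omega u (s, t) v = 0 by apply: Z0.
have [x0|x0] := eqVneq x 0; last first.
  by case/eqP: (plane_charge_neq0 u s amp go ao ag bog x0 t0).
move/eqP: i0; rewrite plane_chargeE //= -/g !mulf_eq0 (gt_eqF t0) (negPf g0') /=.
move=> /eqP y10; apply: (negP K0); apply/eqP.
by move: y10; rewrite x0 mulr0 subr0 => ->; ring.
Qed.
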